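(* Every $[1]$-trade of volume $3$ is a shift of a trade $(\{Y_1,Y_2,Y_3\},\{Z_1,Z_2,Z_3\})$, where $Y_1,Y_2,Y_3$ are mutually disjoint, $Z_1,Z_2,Z_3$ are mutually disjoint, $Y_1\oplus Y_2\oplus Y_3=Z_1\oplus Z_2\oplus Z_3$, and $Y_i\ne Z_j$ for all $i,j\in\{1,2,3\}$.
   Context: Let $V=\{1,\dots,v\}$ and let $\oplus$ denote symmetric difference of subsets. A $[1]$-trade is a pair $T=(T_+,T_-)$ of disjoint finite multisets of subsets of $V$ (blocks) with $|T_+|=|T_-|$ such that every element of $V$ lies in the same number of blocks of $T_+$ as of $T_-$ (with multiplicity); its volume is $|T_+|$. For $Y\subseteq V$, the $Y$-shift of $T$ is the trade obtained by replacing every block $B$ (in both legs, with multiplicity) by $Y\oplus B$; a shift of $T$ is a $Y$-shift for some $Y$. *)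

(* Defs.v *)
From mathcomp Require Export all_boot.
From mathcomp Require Export finmap multiset.

Set Implicit Arguments.
Unset Strict Implicit.
Unset Printing Implicit Defensive.

Local Open Scope mset_scope.

Definition symdiff (T : finType) (A B : {set T}) : {set T} :=
  (A :\: B) :|: (B :\: A).

(* The ground set {1, ..., v} is represented by 'I_v = {0, ..., v - 1}. *)
Definition block (v : nat) := {set 'I_v}.

(* A pair of multisets of blocks: T.1 is the leg T_+ and T.2 the leg T_-. *)
Definition legs (v : nat) := ({mset block v} * {mset block v})%type.

Definition degree (v : nat) (A : {mset block v}) (x : 'I_v) : nat :=
  count (fun B : block v => x \in B) A.

Definition is_1trade (v : nat) (T : legs v) : Prop :=
  [/\ mdisjoint T.1 T.2,
      size T.1 = size T.2
    & forall x : 'I_v, degree T.1 x = degree T.2 x].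

Definition volume (v : nat) (T : legs v) : nat := size T.1.

Definition mset_shift (v : nat) (S : block v) (A : {mset block v}) :
    {mset block v} :=
  seq_mset [seq symdiff S B | B <- A].

Definition shift (v : nat) (S : block v) (T : legs v) : legs v :=
  (mset_shift S T.1, mset_shift S T.2).

(* {Y_1, Y_2, Y_3} is a multiset: two of the Y_i may both be empty. *)
Definition mset_of3 (v : nat) (Y : 'I_3 -> block v) : {mset block v} :=
  seq_mset [seq Y i | i : 'I_3].

(* Main.v *)
(** Let [S] be the set of points lying in at least two of the three blocks of
    [T.1]; by the degree condition it is the same set for [T.2].  Shifting by
    [S] turns every degree [d] with [d >= 2] into [3 - d] and fixes the other
    ones, so all degrees of the shifted trade are at most [1]: the blocks of
    each leg are mutually disjoint.  The symmetric difference of a leg records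
    the parities of its degrees, hence agrees for both legs. *)
Require Import Defs.
From mathcomp Require Import all_boot.
From mathcomp Require Import finmap multiset.

Set Implicit Arguments.
Unset Strict Implicit.
Unset Printing Implicit Defensive.

Section SymmetricDifference.
Variable T : finType.
Implicit Types A B S : {set T}.

Lemma in_symdiff A B x : (x \in symdiff A B) = (x \in A) (+) (x \in B).
Proof. by rewrite !inE; case: (x \in A); case: (x \in B). Qed.

Lemma symdiffK S : involutive (@symdiff T S).
Proof. by move=> B; apply/setP=> x; rewrite !in_symdiff addKb. Qed.

(** Membership of [x] turns [symdiff] into exclusive or, and [odd] turns addition into exclusive or,
    so both sides are the same iterated exclusive or. *)
Lemma in_big_symdiff (I : finType) (Y : I -> {set T}) x :
  (x \in \big[@symdiff T/set0]_i Y i) = odd (\sum_i (x \in Y i)).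
Proof.
rewrite (big_morph (fun A => x \in A) (fun A B => in_symdiff A B x) (in_set0 x)).
by rewrite (big_morph odd oddD (erefl : odd 0 = false));
  apply: eq_bigr => i _; rewrite oddb.
Qed.

(** A point common to [Y i] and [Y j] would contribute two units to the sum. *)
Lemma disjoint_of_sum_le1 (I : finType) (Y : I -> {set T}) :
  (forall x, \sum_i (x \in Y i) <= 1) ->
  forall i j, i != j -> [disjoint Y i & Y j].
Proof.
move=> Yle1 i j neq_ij; apply/pred0P => x /=; apply/negP => /andP[xi xj].
move: (Yle1 x); rewrite (bigD1 i) //= (bigD1 j) 1?eq_sym //=.
by rewrite [x \in Y i]xi [x \in Y j]xj.
Qed.

End SymmetricDifference.

Section Multisets.
Local Open Scope mset_scope.
Variable K : choiceType.
Implicit Types A B : {mset K}.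

Lemma mem_seq_mset (s : seq K) : seq_mset s =i s.
Proof. by move=> a; rewrite -(perm_mem (perm_eq_seq_mset s)) enum_msetE. Qed.

Lemma mdisjointP A B :
  reflect (forall a, a \in A -> a \notin B) (mdisjoint A B).
Proof.
apply: (iffP eqP) => [AB0 a aA | dAB].
  by apply/negP => aB; move: (in_mset0 a); rewrite -AB0 in_msetI aA aB.
apply/msetP => a; rewrite mset0E; apply/mset_eq0P; rewrite in_msetI.
by apply/negP => /andP[/dAB/negP].
Qed.

End Multisets.

Section Shifts.
Local Open Scope mset_scope.
Variable v : nat.
Implicit Types (S B : block v) (A : {mset block v}) (T : legs v).

Lemma degree_seq_mset (s : seq (block v)) x :
  degree (seq_mset s) x = count (fun B : block v => x \in B) s.
Proof. exact/permP/perm_eq_seq_mset. Qed.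

(** Indicator sums are the form in which the disjointness criterion and the parity formula read
    degrees. *)
Lemma degree_mset_of3 (Y : 'I_3 -> block v) x :
  degree (mset_of3 Y) x = \sum_i (x \in Y i).
Proof.
by rewrite degree_seq_mset count_map -sum1_count big_mkcond big_enum.
Qed.

Lemma size_mset_shift S A : size (mset_shift S A) = size A.
Proof. by rewrite (perm_size (perm_eq_seq_mset _)) size_map. Qed.

Lemma mem_mset_shift S A B : (B \in mset_shift S A) = (symdiff S B \in A).
Proof.
rewrite mem_seq_mset -{1}(symdiffK S B) mem_map ?enum_msetE //.
exact: inv_inj (symdiffK S).
Qed.

(** At a point of [S] the shift negates membership, so it counts the blocks of [A] that avoid
    [x]. *)
Lemma degree_mset_shift S A x :
  degree (mset_shift S A) x =
    if x \in S then size A - degree A x else degree A x.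
Proof.
rewrite degree_seq_mset count_map.
rewrite (eq_count (a2 := fun B => (x \in S) (+) (x \in B))); last first.
  by move=> B /=; rewrite in_symdiff.
case: (x \in S) => //=.
by rewrite -(count_predC (fun B => x \in B)) addKn.
Qed.

Lemma mset_shiftK S : involutive (@mset_shift v S).
Proof.
move=> A; rewrite -[RHS]seq_mset_id; apply/eq_seq_msetP.
rewrite (perm_trans (perm_map _ (perm_eq_seq_mset _))) //.
by rewrite (mapK (symdiffK S)).
Qed.

Lemma shiftK S : involutive (@shift v S).
Proof. by case=> A B; rewrite /shift /= !mset_shiftK. Qed.

(** Equal degrees stay equal after complementation because both legs have the same size. *)
Lemma is_1trade_shift S T : is_1trade T -> is_1trade (shift S T).
Proof.
case=> /mdisjointP disT sizeT degT; split=> [||x] /=.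
- by apply/mdisjointP => B; rewrite !mem_mset_shift; apply: disT.
- by rewrite !size_mset_shift.
- by rewrite !degree_mset_shift sizeT degT.
Qed.

Lemma mset_of3_surj A : size A = 3 -> exists Y : 'I_3 -> block v, mset_of3 Y = A.
Proof.
(* The default [set0] is never reached: the indices stay below [size A]. *)
move=> sizeA; exists (fun i => nth set0 A i).
rewrite -[RHS]seq_mset_id; congr seq_mset.
rewrite [LHS](map_comp (nth set0 A) val (enum 'I_3)) val_enum_ord.
by rewrite -sizeA map_nth_iota0 // take_size.
Qed.

Lemma degree_majority_shift A x : size A = 3 ->
  degree (mset_shift [set y | 1 < degree A y] A) x <= 1.
Proof.
(* Degree 2 becomes 1; from 3 on, truncated subtraction gives 0. *)
by move=> sizeA; rewrite degree_mset_shift inE sizeA; case: (degree A x) => [|[|[|]]].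
Qed.

End Shifts.

Theorem theorem6p1 (v : nat) (T : legs v) :
  is_1trade T -> volume T = 3 ->
  exists (S : block v) (Y Z : 'I_3 -> block v),
    [/\ (forall i j : 'I_3, i != j -> [disjoint Y i & Y j]),
        (forall i j : 'I_3, i != j -> [disjoint Z i & Z j]),
        \big[@symdiff _/set0]_(i < 3) Y i = \big[@symdiff _/set0]_(i < 3) Z i,
        (forall i j : 'I_3, Y i != Z j)
      & is_1trade (mset_of3 Y, mset_of3 Z) /\
        T = shift S (mset_of3 Y, mset_of3 Z)].
Proof.
move=> trT volT; pose S : block v := [set x | 1 < degree T.1 x].
have trST := is_1trade_shift S trT.
have sizeT2 : size T.2 = 3 by case: trT => _ <- _.
have [Y defY] : exists Y, mset_of3 Y = mset_shift S T.1.
  by apply: mset_of3_surj; rewrite size_mset_shift.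
have [Z defZ] : exists Z, mset_of3 Z = mset_shift S T.2.
  by apply: mset_of3_surj; rewrite size_mset_shift.
have defST : (mset_of3 Y, mset_of3 Z) = shift S T by rewrite defY defZ.
have [/mdisjointP disYZ _ degYZ] := trST; rewrite -defST /= in disYZ degYZ.
have degYle1 x : \sum_i (x \in Y i) <= 1.
  by rewrite -degree_mset_of3 defY degree_majority_shift.
(* [S] was read off [T.1] alone; equality of degrees in the shifted trade carries the bound over to
   [Z]. *)
have degZle1 x : \sum_i (x \in Z i) <= 1.
  by rewrite -degree_mset_of3 -degYZ degree_mset_of3.
exists S, Y, Z; split.
- exact: disjoint_of_sum_le1.
- exact: disjoint_of_sum_le1.
- by apply/setP=> x; rewrite !in_big_symdiff -!degree_mset_of3 degYZ.
(* If [Y i = Z j], this block would lie in both legs of the shifted trade. *)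
- move=> i j; apply: contraTneq (disYZ (Y i) _) => [->|];
    by rewrite mem_seq_mset ?negbK map_f ?mem_enum.
- by rewrite defST shiftK.
Qed.
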